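(* Let $X$ be a compact Kähler manifold, and let $\mathcal{T}^\cdot_{\mathbb{C}}$, $N$, $\Phi$, $\theta_t$ and $\Upsilon$ be as in the context. There is a unique holomorphic map $\phi^-:\mathbb{P}^1(\mathbb{C})\smallsetminus\{0\}\to\mathrm{Aut}(\mathcal{T}^\cdot_{\mathbb{C}})$ of the form $$\phi^-(z)^{-1}=1+\sum_{k=1}^\infty\frac{d_k}{z^k},\qquad d_k=\int_{s_1\ge\cdots\ge s_k\ge0}\theta_{-s_1}(\beta)\cdots\theta_{-s_k}(\beta)\,ds_1\cdots ds_k,$$ where $\beta=\Upsilon(\mathrm{Res}\,\phi)$, with residue $\mathrm{Res}\,\phi:=\frac{d}{dz}\left(\phi^-(1/z)^{-1}\right)|_{z=0}$ equal to $$\mathrm{Res}\,\phi=N,$$ and it is given by $$\phi^-(z)=\exp(-N/z).$$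
   Context: $X$ has complex dimension $n$; $\Omega^{p,q}_X$ denotes global smooth $(p,q)$-forms; $U,\hbar$ are formal variables. For $p,q\ge0$, $m=p+q$, put $\Lambda_{p,q}=\{(r,k)\in\mathbb{Z}^2: k\ge\max\{0,\,2r+m,\,\tfrac{|p-q|+2r+m}{2}\}\}$. $\mathcal{T}^\cdot$ is the real vector space spanned by the elements $\alpha\otimes U^r\otimes\hbar^k$ with $\alpha=\xi+\bar\xi$, $\xi\in\Omega^{p,q}_X$, and $(r,k)\in\Lambda_{p,q}$; $\mathcal{T}^\cdot_{\mathbb{C}}$ is its complexification. $N=U\hbar$ is the operator sending $\alpha\otimes U^r\otimes\hbar^k$ to $\alpha\otimes U^{r+1}\otimes\hbar^{k+1}$ if $(r+1,k+1)\in\Lambda_{p,q}$ and to $0$ otherwise. $\Phi=-U\frac{\partial}{\partial U}$, i.e. multiplication by $-r$ on $\alpha\otimes U^r\otimes\hbar^k$. The time evolution on endomorphisms $a$ of $\mathcal{T}^\cdot_{\mathbb{C}}$ is $\theta_t(a)=e^{-t\Phi}\,a\,e^{t\Phi}$, with infinitesimal generator $\Upsilon(a)=\frac{d}{dt}\theta_t(a)|_{t=0}=[a,\Phi]$. *)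

(* Defs.v *)
From HB Require Import structures.
From mathcomp Require Import all_boot all_order all_algebra.
From mathcomp Require Import all_classical all_reals all_analysis.
From mathcomp Require Import complex.

Set Implicit Arguments.
Unset Strict Implicit.
Unset Printing Implicit Defensive.

Import Order.TTheory GRing.Theory Num.Theory.
Import numFieldNormedType.Exports.

Local Open Scope classical_set_scope.
Local Open Scope ring_scope.
Local Open Scope complex_scope.

(* C^n as a real normed space: (x, y) stands for x + i y. *)
Definition Cn (R : realType) (n : nat) : normedModType R :=
  ('rV[R]_n * 'rV[R]_n)%type.

Definition Jn (R : realType) (n : nat) (v : Cn R n) : Cn R n := (- v.2, v.1).

Definition cscale (R : realType) (n : nat) (c : R[i]) (v : Cn R n) : Cn R n :=
  complex.Re c *: v + complex.Im c *: Jn v.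

(* A map between open subsets of C^n is holomorphic when it is differentiable
   over R with C-linear differential. *)
Definition holomorphic_at (R : realType) (n : nat) (f : Cn R n -> Cn R n)
    (z : Cn R n) : Prop :=
  differentiable f z /\ forall v, ('d f z : Cn R n -> Cn R n) (Jn v) =
                                  Jn (('d f z : Cn R n -> Cn R n) v).

(* The charts are total functions, only meaningful on [chart_dom] and on its
   image; the atlas need not be maximal. *)
Record complexManifold (R : realType) (n : nat) := ComplexManifold {
  points :> topologicalType ;
  chart_idx : Type ;
  chart_dom : chart_idx -> set points ;
  chart : chart_idx -> points -> Cn R n ;
  chart_inv : chart_idx -> Cn R n -> points ;
  points_hausdorff : hausdorff_space points ;
  chart_cover : forall x, exists i, chart_dom i x ;
  chart_dom_open : forall i, open (chart_dom i) ;
  chart_img_open : forall i, open (chart i @` chart_dom i) ;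
  chartK : forall i x, chart_dom i x -> chart_inv i (chart i x) = x ;
  chart_continuous : forall i x, chart_dom i x ->
    {for x, continuous (chart i)} ;
  chart_inv_continuous : forall i z, (chart i @` chart_dom i) z ->
    {for z, continuous (chart_inv i)} ;
  chart_holomorphic : forall i j z,
    (chart i @` (chart_dom i `&` chart_dom j)) z ->
    holomorphic_at (chart j \o chart_inv i) z
}.

Section forms.
Variables (R : realType) (n : nat) (X : complexManifold R n).

Local Notation E := (Cn R n).

Definition chart_img (i : chart_idx X) : set E := chart i @` chart_dom i.

Definition transition (i j : chart_idx X) : E -> E := chart j \o chart_inv i.

Fixpoint iter_derive (vs : seq E) (f : E -> R) : E -> R :=
  if vs is v :: vs' then fun z => 'D_v (iter_derive vs' f) z else f.

Definition smooth_on (U : set E) (f : E -> R) : Prop :=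
  forall vs z, U z -> {for z, continuous (iter_derive vs f)} /\
                      forall v, derivable (iter_derive vs f) z v.

(* Complex valued, possibly inhomogeneous, differential forms without any
   regularity: [w (i, z, [:: v_1; ...; v_m])] is the value of the degree m part
   at the point of coordinates z in the chart i, on the tangent vectors of
   coordinates v_1, ..., v_m. [Rcomplex R] is R[i] as a real vector space. *)
Definition forms := chart_idx X * E * seq E -> Rcomplex R.

Definition conj_form (w : forms) : forms := fun y => conjc (w y).

Definition degree (m : nat) (w : forms) : Prop :=
  forall i z vs, size vs <> m -> w (i, z, vs) = 0.

Definition multilinear_form (w : forms) : Prop :=
  forall i z vs1 vs2 (a : R) u v,
    w (i, z, vs1 ++ (a *: u + v) :: vs2) =
    a *: w (i, z, vs1 ++ u :: vs2) + w (i, z, vs1 ++ v :: vs2).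

Definition alternating_form (w : forms) : Prop :=
  forall i z vs1 vs2 vs3 u, w (i, z, vs1 ++ u :: vs2 ++ u :: vs3) = 0.

Definition smooth_form (w : forms) : Prop :=
  forall i vs,
    smooth_on (chart_img i) (fun z => complex.Re (w (i, z, vs))) /\
    smooth_on (chart_img i) (fun z => complex.Im (w (i, z, vs))).

(* The local expressions are pullbacks of each other; those of a given form are
   unique as they vanish outside of the image of the chart. *)
Definition compatible_form (w : forms) : Prop :=
  (forall i j z, (chart i @` (chart_dom i `&` chart_dom j)) z ->
     forall vs, w (i, z, vs) =
       w (j, transition i j z,
          [seq ('d (transition i j) z : E -> E) v | v <- vs])) /\
  (forall i z, ~ chart_img i z -> forall vs, w (i, z, vs) = 0).

(* Alternating R-multilinear forms on C^n are of type (p, q) exactly when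
   scaling all the arguments by c multiplies them by c ^ p * conj(c) ^ q. *)
Definition type_form (p q : nat) (w : forms) : Prop :=
  forall i z vs (c : R[i]), size vs = (p + q)%N ->
    w (i, z, [seq cscale c v | v <- vs]) =
    (c ^+ p * conjc c ^+ q) * w (i, z, vs).

Record Omega (p q : nat) (w : forms) : Prop := IsOmega {
  Omega_degree : degree (p + q) w ;
  Omega_multilinear : multilinear_form w ;
  Omega_alternating : alternating_form w ;
  Omega_smooth : smooth_form w ;
  Omega_compatible : compatible_form w ;
  Omega_type : type_form p q w
}.

(* The exterior derivative of w, evaluated on constant vector fields. *)
Definition closed_2form (w : forms) : Prop :=
  forall i z, chart_img i z -> forall u v t : E,
    let dw (P : R[i] -> R) :=
      'D_u (fun y => P (w (i, y, [:: v; t]))) z +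
      'D_v (fun y => P (w (i, y, [:: t; u]))) z +
      'D_t (fun y => P (w (i, y, [:: u; v]))) z in
    dw (@complex.Re R) = 0 /\ dw (@complex.Im R) = 0.

Definition positive_11form (w : forms) : Prop :=
  forall i z, chart_img i z -> forall v : E, v != 0 ->
    0 < (w (i, z, [:: v; Jn v]) : R[i]).

Definition kahler_form (w : forms) : Prop :=
  [/\ Omega 1 1 w, conj_form w = w, closed_2form w & positive_11form w].

End forms.

Record compactKahler (R : realType) (n : nat) := CompactKahler {
  kahler_manifold :> complexManifold R n ;
  kahler_compact : compact [set: points kahler_manifold] ;
  kahler_structure : exists w : forms kahler_manifold, kahler_form w
}.

(* (x, y) stands for x + i y. *)
Definition complexification (R : rcfType) (V : lmodType R) := (V * V)%type.

Section complexification.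
Variables (R : rcfType) (V : lmodType R).
Local Notation VC := (complexification V).

HB.instance Definition _ := GRing.Zmodule.on VC.

Definition complexification_scale (c : R[i]) (v : VC) : VC :=
  (complex.Re c *: v.1 - complex.Im c *: v.2,
   complex.Re c *: v.2 + complex.Im c *: v.1).

Lemma complexification_scaleA a b v :
  complexification_scale a (complexification_scale b v) =
  complexification_scale (a * b) v.
Proof.
case: a b v => [a a'] [b b'] [x y]; congr pair => /=.
- rewrite scalerBr scalerDr !scalerA scalerBl scalerDl !opprD !addrA.
  by rewrite addrAC; congr (_ - _); rewrite addrAC.
- rewrite scalerBr scalerDr !scalerA scalerBl scalerDl !addrA.
  by rewrite addrAC; congr (_ + _); rewrite addrAC.
Qed.

Lemma complexification_scale1 : left_id 1 complexification_scale.
Proof.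
by case=> x y; rewrite /complexification_scale /= !scale1r !scale0r subr0 addr0.
Qed.

Lemma complexification_scaleDr : right_distributive complexification_scale +%R.
Proof.
case=> [a a'] [x y] [x' y']; congr pair => /=; rewrite !scalerDr ?opprD.
- by rewrite addrACA.
- by rewrite addrACA.
Qed.

Lemma complexification_scaleDl v :
  {morph complexification_scale^~ v : a b / a + b}.
Proof.
move=> [a a'] [b b']; case: v => [x y]; congr pair => /=.
- by rewrite !scalerDl opprD addrACA.
- by rewrite !scalerDl addrACA.
Qed.

HB.instance Definition _ := GRing.Zmodule_isLmodule.Build R[i] VC
  complexification_scaleA complexification_scale1
  complexification_scaleDr complexification_scaleDl.

Definition complexify (f : V -> V) (v : VC) : VC := (f v.1, f v.2).

End complexification.

Definition rspan (R : pzRingType) (V : lmodType R) (S : set V) : set V :=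
  [set v | exists (m : nat) (c : 'I_m -> R) (g : 'I_m -> V),
     (forall i, S (g i)) /\ v = \sum_(i < m) c i *: g i].

Lemma rspan_gen (R : pzRingType) (V : lmodType R) (S : set V) v :
  S v -> rspan S v.
Proof.
move=> Sv; exists 1%N, (fun=> 1), (fun=> v); split=> //.
by rewrite big_ord1 scale1r.
Qed.

Lemma rspan0 (R : pzRingType) (V : lmodType R) (S : set V) : rspan S 0.
Proof.
by exists 0%N, (fun=> 0), (fun=> 0); split=> [[]//|]; rewrite big_ord0.
Qed.

Lemma rspanP (R : pzRingType) (V : lmodType R) (S : set V) a u v :
  rspan S u -> rspan S v -> rspan S (a *: u + v).
Proof.
move=> [m [c [g [gS ->]]]] [m' [c' [g' [gS' ->]]]].
exists (m + m')%N,
  (fun i : 'I_(m + m') =>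
     match fintype.split i with inl j => a * c j | inr j => c' j end),
  (fun i : 'I_(m + m') =>
     match fintype.split i with inl j => g j | inr j => g' j end); split.
  by move=> i; case: fintype.split.
rewrite big_split_ord /= scaler_sumr; congr (_ + _); apply: eq_bigr => i _.
- by rewrite (unsplitK (inl i)) scalerA.
- by rewrite (unsplitK (inr i)).
Qed.

Lemma rspan_map (R : pzRingType) (V : lmodType R) (S : set V) (f : V -> V) :
  linear f -> (forall v, S v -> rspan S (f v)) ->
  forall v, rspan S v -> rspan S (f v).
Proof.
move=> fL fS _ [m [c [g [gS ->]]]].
have f0 : f 0 = 0.
  by have := fL (- 1) 0 0; rewrite scaleN1r addNr scaleN1r addNr.
elim/big_rec: _ => [|i v _ vS]; first by rewrite f0; exact: rspan0.
by rewrite fL; apply: rspanP => //; exact: fS.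
Qed.

Section spanned.
Variables (R : pzRingType) (V : lmodType R) (S : set V).

Definition rspan_pred : {pred V} := fun v => `[< rspan S v >].

Lemma rspan_pred_submod : submod_closed rspan_pred.
Proof.
split; first exact/asboolP/rspan0.
by move=> a u v /asboolP uS /asboolP vS; apply/asboolP/rspanP.
Qed.

HB.instance Definition _ :=
  GRing.isSubmodClosed.Build R V rspan_pred rspan_pred_submod.

Record spanned := Spanned { spanned_val : V ; _ : spanned_val \in rspan_pred }.

HB.instance Definition _ := [isSub for spanned_val].
HB.instance Definition _ := [Choice of spanned by <:].
HB.instance Definition _ := [SubChoice_isSubLmodule of spanned by <:].

Lemma spanned_map_subproof (f : V -> V) (fL : linear f)
    (fS : forall v, S v -> rspan S (f v)) (v : spanned) :
  f (val v) \in rspan_pred.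
Proof. by apply/asboolP/rspan_map => //; apply/asboolP/(valP v). Qed.

Definition spanned_map (f : V -> V) (fL : linear f)
    (fS : forall v, S v -> rspan S (f v)) (v : spanned) : spanned :=
  Spanned (spanned_map_subproof fL fS v).

End spanned.

Definition Lambda (p q : nat) (r k : int) : bool :=
  [&& 0 <= k, 2 * r + (p + q)%:Z <= k
    & `|p%:Z - q%:Z| + 2 * r + (p + q)%:Z <= 2 * k].

Lemma Lambda_sym p q r k : Lambda p q r k = Lambda q p r k.
Proof. by rewrite /Lambda distrC addnC. Qed.

Section complexT.
Variables (R : realType) (n : nat) (X : complexManifold R n).

(* [t (p, q, r, k)] is the component of type (p, q) of the coefficient of
   U^r \hbar^k. *)
Definition Tambient := nat * nat * int * int -> forms X.

(* (xi + conj xi) U^r \hbar^k, for xi of type (p, q) *)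
Definition Tgen (p q : nat) (xi : forms X) (r k : int) : Tambient :=
  fun x => let: (p', q', r', k') := x in
    if (r' == r) && (k' == k) then
      (if (p' == p) && (q' == q) then xi else 0) +
      (if (p' == q) && (q' == p) then conj_form xi else 0)
    else 0.

Definition is_Tgen : set Tambient :=
  [set t | exists p q xi r k,
     [/\ Omega p q xi, Lambda p q r k & t = Tgen p q xi r k]].

Definition Nambient (t : Tambient) : Tambient :=
  fun x => let: (p, q, r, k) := x in
    if Lambda p q r k then t (p, q, r - 1, k - 1) else 0.

Definition Phiambient (t : Tambient) : Tambient :=
  fun x => let: (p, q, r, k) := x in (- r)%:~R *: t (p, q, r, k).

Lemma TambientE a (t u : Tambient) x : (a *: t + u) x = a *: t x + u x.
Proof. by []. Qed.

Lemma Nambient_linear : linear Nambient.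
Proof.
move=> a u v; apply/funext=> -[[[p q] r] k]; rewrite TambientE /Nambient.
by case: ifP => _; rewrite ?TambientE // scaler0 addr0.
Qed.

Lemma Phiambient_linear : linear Phiambient.
Proof.
move=> a u v; apply/funext=> -[[[p q] r] k].
by rewrite TambientE /Phiambient TambientE scalerDr !scalerA mulrC.
Qed.

Lemma Nambient_Tgen p q xi r k :
  Nambient (Tgen p q xi r k) =
  if Lambda p q (r + 1) (k + 1) then Tgen p q xi (r + 1) (k + 1) else 0.
Proof.
apply/funext=> -[[[p' q'] r'] k'].
transitivity (if Lambda p q (r + 1) (k + 1)
              then Tgen p q xi (r + 1) (k + 1) (p', q', r', k') else 0);
  last by case: ifP.
rewrite /Nambient /Tgen !subr_eq.
have [/andP[/eqP-> /eqP->]|_] := boolP ((r' == r + 1) && (k' == k + 1)).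
  have [/andP[/eqP-> /eqP->] //|_] := boolP ((p' == p) && (q' == q)).
  have [/andP[/eqP-> /eqP->]|_] := boolP ((p' == q) && (q' == p)).
    by rewrite Lambda_sym.
  by rewrite addr0 !if_same.
by rewrite !if_same.
Qed.

Lemma Phiambient_Tgen p q xi r k :
  Phiambient (Tgen p q xi r k) = (- r)%:~R *: Tgen p q xi r k.
Proof.
apply/funext=> -[[[p' q'] r'] k'].
transitivity ((- r)%:~R *: Tgen p q xi r k (p', q', r', k')) => //.
rewrite /Phiambient /Tgen.
by case: ifP => [/andP[/eqP->]|] //; rewrite !scaler0.
Qed.

Lemma Nambient_span t : is_Tgen t -> rspan is_Tgen (Nambient t).
Proof.
move=> [p [q [xi [r [k [xiO _ ->]]]]]]; rewrite Nambient_Tgen.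
case: ifPn => [L|_]; last exact: rspan0.
by apply: rspan_gen; exists p, q, xi, (r + 1), (k + 1).
Qed.

Lemma Phiambient_span t : is_Tgen t -> rspan is_Tgen (Phiambient t).
Proof.
move=> [p [q [xi [r [k [xiO L ->]]]]]].
rewrite Phiambient_Tgen -[X in rspan _ X]addr0.
by apply: rspanP (rspan0 _); apply: rspan_gen; exists p, q, xi, r, k.
Qed.

Definition T := spanned is_Tgen.

Definition TC := complexification T.

Definition N : TC -> TC :=
  complexify (spanned_map Nambient_linear Nambient_span).

Definition Phi : TC -> TC :=
  complexify (spanned_map Phiambient_linear Phiambient_span).

End complexT.

Arguments N {R n} X.
Arguments Phi {R n} X.

(* A complex vector space without any given topology carries the weak topology
   defined by all its linear forms. Its bounded subsets span subspaces of finite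
   dimension, so that the notions below are those of the usual calculus in
   finite dimensional subspaces. The endomorphisms carry the topology of
   pointwise convergence. *)
Section weak.
Variables (R : realType) (V : lmodType R[i]).
Implicit Types (l : {scalar V}) (A B : V -> V).

Definition weak_cvg (u : nat -> V) (v : V) : Prop :=
  forall l, (fun k => l (u k) : R[i]^o) @ \oo --> (l v : R[i]^o).

Definition weak_derivable (f : R[i] -> V) (w : R[i]) : Prop :=
  forall l, derivable (fun z : R[i]^o => l (f z) : R[i]^o) (w : R[i]^o) 1.

Definition is_weak_derive (f : R[i] -> V) (w : R[i]) (v : V) : Prop :=
  forall l, is_derive (w : R[i]^o) 1 (fun z : R[i]^o => l (f z) : R[i]^o) (l v).

Definition is_weak_Rderive (f : R -> V) (t : R) (v : V) : Prop :=
  forall l,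
    is_derive t 1 (fun s => complex.Re (l (f s))) (complex.Re (l v)) /\
    is_derive t 1 (fun s => complex.Im (l (f s))) (complex.Im (l v)).

(* [is_simplex_integral k D F I] : I is the iterated integral of
   F [:: s_1; ...; s_k] ds_k ... ds_1 over
   s_1 \in D, 0 <= s_2 <= s_1, ..., 0 <= s_k <= s_(k-1),
   including the integrability at each stage. *)
Fixpoint is_simplex_integral (k : nat) (D : set R) (F : seq R -> R) (I : R) :
    Prop :=
  if k is k'.+1 then
    exists G : R -> R,
      [/\ forall s, D s ->
            is_simplex_integral k' `[0, s] (fun ss => F (s :: ss)) (G s),
          (@lebesgue_measure R).-integrable D (EFin \o G)
        & I = \int[@lebesgue_measure R]_(s in D) G s]
  else I = F [::].

Definition is_weak_simplex_integral (k : nat) (f : seq R -> V) (v : V) : Prop :=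
  forall l,
    is_simplex_integral k `[0, +oo[ (fun s => complex.Re (l (f s)))
      (complex.Re (l v)) /\
    is_simplex_integral k `[0, +oo[ (fun s => complex.Im (l (f s)))
      (complex.Im (l v)).

Definition exp_series A (v : V) (m : nat) : V :=
  \sum_(0 <= k < m) (k`!%:R)^-1 *: iter k A v.

Definition is_exp A B : Prop := forall v, weak_cvg (exp_series A v) (B v).

(* The value is 0 where the series diverges. *)
Definition expop A (v : V) : V := xget 0 [set w | weak_cvg (exp_series A v) w].

Record aut := Aut {
  aut_fun :> {linear V -> V} ;
  aut_inv : {linear V -> V} ;
  aut_funK : cancel aut_fun aut_inv ;
  aut_invK : cancel aut_inv aut_fun
}.

End weak.

(* None is the point at infinity. *)
Definition P1 (R : realType) := option R[i].

Definition P1star (R : realType) := {z : P1 R | z != Some 0}.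

(* 1 / z, with value 0 at infinity *)
Definition P1inv (R : realType) (z : P1star R) : R[i] :=
  if val z is Some x then x^-1 else 0.

Definition P1chart_val (R : realType) (w : R[i]) : P1 R :=
  if w == 0 then None else Some w^-1.

Lemma P1chart_subproof (R : realType) (w : R[i]) : P1chart_val w != Some 0.
Proof.
rewrite /P1chart_val; case: (eqVneq w 0) => // w0.
by apply/eqP => -[] /eqP; rewrite invr_eq0 (negPf w0).
Qed.

(* w |-> 1 / w is a biholomorphism from C to P^1(C) minus 0. *)
Definition P1chart (R : realType) (w : R[i]) : P1star R :=
  exist _ (P1chart_val w) (P1chart_subproof w).

Definition P1holomorphic (R : realType) (V : lmodType R[i])
    (phi : P1star R -> aut V) : Prop :=
  forall v w, weak_derivable (fun w => phi (P1chart w) v) w.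

Definition is_residue (R : realType) (V : lmodType R[i])
    (phi : P1star R -> aut V) (A : V -> V) : Prop :=
  forall v, is_weak_derive (fun w => aut_inv (phi (P1chart w)) v) 0 (A v).

Section evolution.
Variables (R : realType) (V : lmodType R[i]) (F : V -> V).

Definition theta (t : R) (a : V -> V) : V -> V :=
  expop (fun u => (- t)%:C *: F u) \o a \o expop (fun u => t%:C *: F u).

Definition is_Upsilon (a b : V -> V) : Prop :=
  forall v, is_weak_Rderive (fun t => theta t a v) 0 (b v).

(* theta_(-s_1)(b) ... theta_(-s_k)(b) *)
Definition theta_prod (b : V -> V) (s : seq R) : V -> V :=
  foldr (fun t a => theta (- t) b \o a) id s.

End evolution.

(* Main.v *)
(* Since [N] raises the power of U by one and [Phi] is diagonal, [N, Phi] = N, so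
   beta = N and theta_t(N) = e^t N. Hence d_k is N^k times the volume of the
   simplex s_1 >= ... >= s_k >= 0 for the density e^(-s) ds, which is 1 / k!, and
   the series for phi^-(z)^(-1) is that of exp(N / z). It is a finite sum on each
   vector because N is locally nilpotent. Uniqueness holds because linear forms
   separate points, so that weak limits, derivatives and integrals are unique. *)
From HB Require Import structures.
Require Import Defs.
From mathcomp Require Import all_boot all_order all_algebra.
From mathcomp Require Import all_classical all_reals all_analysis.
From mathcomp Require Import measurable_realfun complex zify.
Import Order.TTheory GRing.Theory Num.Theory.
Import numFieldNormedType.Exports.
Local Open Scope classical_set_scope.
Local Open Scope ring_scope.
Local Open Scope complex_scope.

Set Implicit Arguments.
Unset Strict Implicit.
Unset Printing Implicit Defensive.

(** * Iterated integrals over a simplex for the density [expR (- s)] *)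

Section simplex.
Variable R : realType.
Implicit Types (D : set R) (F : seq R -> R) (c t : R).

(** By induction the inner integrals [G] and [H] agree on [D], which is all that the outer integral
    sees. *)
Lemma simplex_integral_unique k D F (I J : R) :
  is_simplex_integral k D F I -> is_simplex_integral k D F J -> I = J.
Proof.
elim: k D F I J => [|k IHk] D F I J /=; first by move=> -> ->.
move=> [G [GF _ ->]] [H [HF _ ->]]; apply: eq_Rintegral => s /set_mem Ds.
exact: IHk (GF s Ds) (HF s Ds).
Qed.

(* The volume of [0 <= s_k <= ... <= s_1 <= t] for the density [expR (- s) ds]. *)
Definition simplex_vol k t : R := (1 - expR (- t)) ^+ k / k`!%:R.

(** Slicing the simplex at [s_1 = t]: the slice has volume [simplex_vol k t], weighted by the
    density at [t]. This makes the next volume a primitive of the integrand, so that the fundamental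
    theorem of calculus computes each stage. *)
Lemma simplex_vol_derive k t :
  is_derive t 1 (simplex_vol k.+1) (simplex_vol k t * expR (- t)).
Proof.
have dE : is_derive t 1 (fun s => expR (- s)) (- expR (- t)).
  by apply: is_derive_eq (is_derive1_comp _ _) _; rewrite ?mulrN1.
rewrite (_ : simplex_vol k.+1 =
    (k.+1`!%:R^-1 : R) \*: (cst 1 - (fun s => expR (- s))) ^+ k.+1); last first.
  by apply/funext => s; rewrite /simplex_vol /= fctE/= mulrC.
apply: is_derive_eq; rewrite /= add0r opprK factS natrM invfM /GRing.scale/=.
by rewrite fctE/= mulrACA mulKf ?pnatr_eq0// mulrA.
Qed.

Lemma simplex_vol_ge0 k t : 0 <= t -> 0 <= simplex_vol k t.
Proof.
move=> t0; rewrite mulr_ge0 ?invr_ge0 ?ler0n// exprn_ge0// subr_ge0.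
by rewrite -expR0 ler_expR oppr_le0.
Qed.

Lemma simplex_density_ge0 k t : 0 <= t -> 0 <= simplex_vol k t * expR (- t).
Proof. by move=> t0; rewrite mulr_ge0 ?expR_ge0// simplex_vol_ge0. Qed.

Lemma simplex_vol_continuous k : continuous (simplex_vol k).
Proof.
(* The derivative formula covers the successor indices only; for index 0 the volume is constantly
   1. *)
case: k => [|k] t; last first.
  apply: differentiable_continuous; apply/derivable1_diffP.
  by have [] := simplex_vol_derive k t.
rewrite (_ : simplex_vol 0 = cst 1); first exact: cst_continuous.
by apply/funext => s; rewrite /simplex_vol expr0 divr1.
Qed.

Lemma simplex_density_continuous k :
  continuous (fun t => simplex_vol k t * expR (- t)).
Proof.
move=> t; apply: cvgM; first exact: simplex_vol_continuous.
apply: (@continuous_comp _ _ _ -%R expR); first exact: opp_continuous.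
exact: continuous_expR.
Qed.

Lemma simplex_volS0 k : simplex_vol k.+1 0 = 0.
Proof. by rewrite /simplex_vol oppr0 expR0 subrr expr0n mul0r. Qed.

Lemma simplex_volS_derive1 k :
  (simplex_vol k.+1)^`()%classic = (fun t => simplex_vol k t * expR (- t)).
Proof.
by apply/funext => t; rewrite derive1E;
   exact: (@derive_val _ _ _ _ _ _ _ (simplex_vol_derive k t)).
Qed.

Lemma simplex_vol_derivable k t : derivable (simplex_vol k.+1) t 1.
Proof. by have [] := simplex_vol_derive k t. Qed.

Lemma Rintegral_simplex_density k t : 0 <= t ->
  \int[@lebesgue_measure R]_(s in `[0, t]) (simplex_vol k s * expR (- s)) =
  simplex_vol k.+1 t.
Proof.
(* The fundamental theorem is applied on a nondegenerate interval, so [t = 0] is treated apart. *)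
rewrite le_eqVlt => /predU1P[<-|t0].
  by rewrite set_itv1 Rintegral_set1 simplex_volS0.
rewrite /Rintegral (continuous_FTC2 (F := simplex_vol k.+1)) //.
- by rewrite simplex_volS0 sube0.
- exact/continuous_subspaceT/simplex_density_continuous.
- split=> [s _||]; first exact: simplex_vol_derivable.
    exact/cvg_at_right_filter/simplex_vol_continuous.
  exact/cvg_at_left_filter/simplex_vol_continuous.
- by move=> s _; rewrite simplex_volS_derive1.
Qed.

Lemma simplex_vol_cvgy k : simplex_vol k t @[t --> +oo] --> (k`!%:R^-1 : R).
Proof.
rewrite -[X in _ --> X]mul1r; apply: cvgM (cvg_cst _).
rewrite -[X in _ --> X](expr1n _ k).
apply: (cvg_comp (fun t => 1 - expR (- t)) (fun x : R => x ^+ k));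
  last exact: exprn_continuous.
suff: 1 - expR (- t) @[t --> +oo] --> (1 - 0 : R) by rewrite subr0.
by apply: cvgB; [exact: cvg_cst|exact: cvgr_expR].
Qed.

Lemma integral_simplex_densityy k :
  (\int[@lebesgue_measure R]_(s in `[0%R, +oo[)
    (simplex_vol k s * expR (- s))%:E)%E = (k.+1`!%:R^-1 : R)%:E.
Proof.
rewrite (ge0_continuous_FTC2y (F := simplex_vol k.+1) (l := k.+1`!%:R^-1)).
- by rewrite simplex_volS0 sube0.
- by move=> s; exact: simplex_density_ge0.
- exact/continuous_subspaceT/simplex_density_continuous.
- exact: simplex_vol_cvgy.
- by move=> s _; exact: simplex_vol_derivable.
- exact/cvg_at_right_filter/simplex_vol_continuous.
- by move=> s _; rewrite simplex_volS_derive1.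
Qed.

Lemma integrable_simplex_density k t :
  (@lebesgue_measure R).-integrable `[0, t]
    (EFin \o (fun s => simplex_vol k s * expR (- s))).
Proof.
apply: continuous_compact_integrable; first exact: segment_compact.
exact/continuous_subspaceT/simplex_density_continuous.
Qed.

Lemma integrable_simplex_densityy k :
  (@lebesgue_measure R).-integrable `[0 : R, +oo[
    (EFin \o (fun s => simplex_vol k s * expR (- s))).
Proof.
apply/integrableP; split.
  apply/measurable_EFinP; apply: measurable_funTS.
  apply: continuous_measurable_fun; exact: simplex_density_continuous.
under eq_integral => s.
  rewrite inE/= in_itv/= andbT => s0.
  rewrite /= ger0_norm; last exact: simplex_density_ge0.
  over.
by rewrite /= integral_simplex_densityy ltry.
Qed.

(** One induction step serves both ranges of the outer variable, a segment and the half-line. The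
    induction hypothesis quantifies over the constant because fixing the outer variable [s] moves
    its factor [expR (- s)] into that constant. *)
Lemma is_simplex_integralS k D c :
  measurable D -> (forall s, D s -> 0 <= s) ->
  (@lebesgue_measure R).-integrable D
    (EFin \o (fun s => simplex_vol k s * expR (- s))) ->
  (forall s c, 0 <= s ->
     is_simplex_integral k `[0, s] (fun ss => (\prod_(x <- ss) expR (- x)) * c)
       (simplex_vol k s * c)) ->
  is_simplex_integral k.+1 D (fun ss => (\prod_(x <- ss) expR (- x)) * c)
    (\int[@lebesgue_measure R]_(s in D) (simplex_vol k s * expR (- s)) * c).
Proof.
move=> mD D0 iD IH; exists (fun s => simplex_vol k s * expR (- s) * c); split.
- move=> s /D0 s0; rewrite -mulrA (_ : (fun ss => _) =
      (fun ss => (\prod_(x <- ss) expR (- x)) * (expR (- s) * c))); last first.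
    by apply/funext => ss; rewrite big_cons mulrCA mulrA.
  exact: IH.
- rewrite (_ : _ \o _ =
    (fun s => (simplex_vol k s * expR (- s))%:E * c%:E)%E) //.
  exact: integrableZr.
- by rewrite RintegralZr.
Qed.

Lemma is_simplex_integral_prod_expR k c t : 0 <= t ->
  is_simplex_integral k `[0, t] (fun ss => (\prod_(x <- ss) expR (- x)) * c)
    (simplex_vol k t * c).
Proof.
elim: k c t => [|k IHk] c t t0.
  by rewrite /= big_nil /simplex_vol expr0 divr1.
rewrite -Rintegral_simplex_density //; apply: is_simplex_integralS.
- exact: measurable_itv.
- by move=> s; rewrite /= in_itv/= => /andP[].
- exact: integrable_simplex_density.
- by move=> s d; exact: IHk.
Qed.

Lemma is_simplex_integral_prod_expRy k c : (0 < k)%N ->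
  is_simplex_integral k `[0, +oo[ (fun ss => (\prod_(x <- ss) expR (- x)) * c)
    (k`!%:R^-1 * c).
Proof.
(* A real integral is the [fine] of the extended one, so this form lets the improper integral
   replace the constant. Only the outer variable is unbounded; the inner ones fall under the
   previous lemma. *)
case: k => // k _; rewrite -[X in X * c]/(fine (k.+1`!%:R^-1)%:E).
rewrite -integral_simplex_densityy; apply: is_simplex_integralS.
- exact: measurable_itv.
- by move=> s; rewrite /= in_itv/= andbT.
- exact: integrable_simplex_densityy.
- by move=> s d; exact: is_simplex_integral_prod_expR.
Qed.

End simplex.

(** * Complex limits of real sequences, and finite sums for products of exponentials *)

Lemma real_complex_cvg (R : realType) (u : nat -> R) (x : R) :
  u @ \oo --> x -> (fun k => (u k)%:C : R[i]^o) @ \oo --> (x%:C : R[i]^o).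
Proof.
move=> /cvgrPdist_lt ux; apply/cvgrPdist_lt => -[e e'] e0.
(* In the partial order of [R[i]], a positive element is real. *)
have /andP[/eqP/= -> e_gt0] : (e' == 0) && (0 < e).
  by move: e0; rewrite ltcE/= eq_sym.
near=> k; rewrite -rmorphB/= normc_def/= expr0n addr0 sqrtr_sqr ltcR.
by near: k; exact: ux.
Unshelve. all: by end_near. Qed.

(** A truncated Cauchy product: the square is reordered along the diagonals [i + j = k], and its
    part beyond the last diagonal vanishes. *)
Lemma sum_square_diagonal (V : nmodType) m (f : nat -> nat -> V) :
  (forall i j, (m <= i + j)%N -> f i j = 0) ->
  \sum_(0 <= i < m) \sum_(0 <= j < m) f i j =
  \sum_(0 <= k < m) \sum_(0 <= i < k.+1) f i (k - i)%N.
Proof.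
move=> f0; transitivity
  (\sum_(0 <= k < m) \sum_(0 <= i < m | (i <= k)%N) f i (k - i)%N); last first.
  rewrite big_nat [RHS]big_nat; apply: eq_bigr => k /andP[_ km].
  by rewrite [RHS](big_nat_widen _ _ m).
rewrite [RHS](exchange_big_dep_nat xpredT)//= big_nat [RHS]big_nat.
apply: eq_bigr => i /andP[_ im].
transitivity (\sum_(i <= k < m) f i (k - i)%N); last first.
  by rewrite (big_nat_widenl _ 0).
rewrite -{2}(add0n i) big_addn.
rewrite (big_cat_nat (leq0n (m - i)) (leq_subr i m))/= [X in _ + X]big_nat.
rewrite [X in _ + X]big1 ?addr0 => [|j /andP[mij _]]; last first.
  by rewrite f0// -leq_subLR.
by apply: eq_bigr => j _; rewrite addnK.
Qed.

(** This is the binomial expansion of [(1 - 1) ^+ k], divided by [k!]; it gives the coefficients of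
    the product of exp(-x) and exp(x). *)
Lemma sum_sign_inv_fact (K : numFieldType) k :
  \sum_(0 <= i < k.+1) ((-1) ^+ i / i`!%:R / (k - i)`!%:R) = (k == 0)%:R :> K.
Proof.
transitivity (((1 - 1) ^+ k : K) / k`!%:R); last first.
  by rewrite subrr expr0n; case: eqP => [->|_]; rewrite ?mul0r// divr1.
rewrite exprDn big_mkord mulr_suml; apply: eq_bigr => i _.
have ik : (i <= k)%N by rewrite -ltnS.
rewrite expr1n mul1r -[_ *+ 'C(k, i)]mulr_natr -!mulrA; congr (_ * _).
by rewrite -(bin_fact ik) !natrM !invfM mulVKf// pnatr_eq0 -lt0n bin_gt0.
Qed.

(** * Weak convergence and exponential series *)

Section weak_calculus.
Variables (R : realType) (V : lmodType R[i]).
Implicit Types (A B : {linear V -> V}) (u v w : V).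

(** The condition that makes weak limits, derivatives and integrals unique. It is checked for [TC X]
    by evaluating forms. *)
Definition weakly_separated :=
  forall v, (forall l : {scalar V}, l v = 0) -> v = 0.

Lemma weak_cvgZD (f g : nat -> V) v w a :
  weak_cvg f v -> weak_cvg g w ->
  weak_cvg (fun k => a *: f k + g k) (a *: v + w).
Proof.
move=> fv gw l; rewrite linearP (_ : (fun k => _) =
    (fun k => a * l (f k) + l (g k))); last first.
  by apply/funext => k; rewrite linearP.
by apply: (@cvgD R[i] R[i]^o _ \oo _ (fun k => a * l (f k)));
  [apply: (@cvgM R[i] _ \oo _ (fun=> a)); [exact: cvg_cst|exact: fv]|exact: gw].
Qed.

Lemma weak_cvg_eventually (f : nat -> V) v m :
  (forall k, (m <= k)%N -> f k = v) -> weak_cvg f v.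
Proof.
move=> fv l; apply: cvg_near_cst; near=> k; congr (l _); apply: fv.
by near: k; exact: nbhs_infty_ge.
Unshelve. all: by end_near. Qed.

Lemma iterZD A k : linear (iter k A).
Proof. by elim: k => // k IHk a u v; rewrite !iterS IHk linearP. Qed.

Lemma iter0r A k : iter k A 0 = 0.
Proof. by elim: k => // k IHk; rewrite iterS IHk linear0. Qed.

Lemma iter_eigen A (x : R[i]) v k : A v = x *: v -> iter k A v = x ^+ k *: v.
Proof.
move=> Av; elim: k => [|k IHk]; first by rewrite scale1r.
by rewrite iterS IHk linearZ/= Av scalerA exprSr.
Qed.

Lemma iter_scale A (x : R[i]) v k :
  iter k (fun v => x *: A v) v = x ^+ k *: iter k A v.
Proof.
elim: k => [|k IHk]; first by rewrite scale1r.
by rewrite !iterS IHk linearZ/= scalerA exprS.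
Qed.

Lemma exp_series_linear A m : linear (fun v => exp_series A v m).
Proof.
move=> a u v; rewrite /exp_series scaler_sumr -big_split/=.
by apply: eq_bigr => k _; rewrite iterZD scalerDr !scalerA mulrC.
Qed.

Lemma exp_series_eigen A (x : R) v m : A v = x%:C *: v ->
  exp_series A v m = (series (exp_coeff x) m)%:C *: v.
Proof.
move=> Av; rewrite /exp_series /series/= rmorph_sum/= scaler_suml.
apply: eq_bigr => k _; rewrite (iter_eigen k Av) scalerA /exp_coeff/=.
by rewrite rmorphM rmorphXn fmorphV rmorph_nat/= mulrC.
Qed.

Lemma exp_series_eigen_cvg A (x : R) v : A v = x%:C *: v ->
  weak_cvg (exp_series A v) ((expR x)%:C *: v).
Proof.
move=> Av l; rewrite linearZ/= (_ : (fun k => _) =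
    (fun k => (series (exp_coeff x) k)%:C * l v)); last first.
  by apply/funext => k; rewrite (exp_series_eigen _ Av) linearZ.
apply: (@cvgM R[i] _ \oo); last exact: cvg_cst.
apply: real_complex_cvg; exact: is_cvg_series_exp_coeff.
Qed.

Lemma exp_series_stable A v m k : iter m A v = 0 -> (m <= k)%N ->
  exp_series A v k = exp_series A v m.
Proof.
move=> Amv mk; rewrite /exp_series (big_cat_nat (leq0n m) mk)/= -[RHS]addr0.
congr (_ + _).
rewrite big_nat_cond big1// => i /andP[/andP[mi _] _].
by rewrite -(subnK mi) iterD Amv iter0r scaler0.
Qed.

HB.instance Definition _ A k :=
  GRing.isLinear.Build _ _ _ _ (iter k A) (iterZD A k).

(** The product of the truncated series of exp(-A) and exp(A) is a double sum whose terms with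
    [m <= i + j] kill [v]; grouped by diagonals, only the one of degree 0 remains. *)
Lemma exp_seriesNK A v m : iter m A v = 0 ->
  exp_series (fun v => - A v) (exp_series A v m) m = v.
Proof.
move=> Amv; pose c i j : R[i] := (-1) ^+ i / i`!%:R / j`!%:R.
transitivity (\sum_(0 <= i < m) \sum_(0 <= j < m) c i j *: iter (i + j) A v).
  apply: eq_bigr => i _; rewrite (_ : (fun v => - A v) = (fun v => -1 *: A v));
    last by apply/funext => u; rewrite scaleN1r.
  rewrite iter_scale scalerA linear_sum scaler_sumr; apply: eq_bigr => j _.
  by rewrite linearZ/= scalerA iterD [_^-1 * _]mulrC.
rewrite sum_square_diagonal => [|i j mij]; last first.
  by rewrite -(subnK mij) iterD Amv iter0r scaler0.
transitivity (\sum_(0 <= k < m) (k == 0)%:R *: iter k A v).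
  apply: eq_bigr => k _; rewrite -(sum_sign_inv_fact R[i]) scaler_suml.
  by apply: eq_big_nat => i /andP[_ ik]; rewrite subnKC.
(* For [m = 0] the hypothesis says that [v = 0], which agrees with the empty sum. *)
case: m Amv => [/= ->|m _]; first by rewrite big_geq.
rewrite big_nat_recl// scale1r big1 ?addr0// => i _; exact: scale0r.
Qed.

End weak_calculus.

(** * Uniqueness of weak limits, and the time evolution of a diagonalizable generator *)

Section separated.
Variables (R : realType) (V : lmodType R[i]).
Hypothesis Vsep : weakly_separated V.
Implicit Types (u v w : V).

Lemma weakly_separatedP v w : (forall l : {scalar V}, l v = l w) -> v = w.
Proof.
by move=> vw; apply/subr0_eq/Vsep => l; rewrite linearB vw subrr.
Qed.

Lemma weak_cvg_unique (f : nat -> V) v w :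
  weak_cvg f v -> weak_cvg f w -> v = w.
Proof.
move=> fv fw; apply: weakly_separatedP => l.
exact: (cvg_unique (@norm_hausdorff _ R[i]^o) (fv l) (fw l)).
Qed.

Lemma is_weak_Rderive_unique (f : R -> V) t v w :
  is_weak_Rderive f t v -> is_weak_Rderive f t w -> v = w.
Proof.
move=> fv fw; apply: weakly_separatedP => l.
have [[dRv dIv] [dRw dIw]] := (fv l, fw l).
apply/eqP; rewrite eq_complex -(@derive_val _ _ _ _ _ _ _ dRv).
rewrite -(@derive_val _ _ _ _ _ _ _ dIv) -(@derive_val _ _ _ _ _ _ _ dRw).
by rewrite -(@derive_val _ _ _ _ _ _ _ dIw) !eqxx.
Qed.

Lemma is_weak_simplex_integral_unique k (f : seq R -> V) v w :
  is_weak_simplex_integral k f v -> is_weak_simplex_integral k f w -> v = w.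
Proof.
move=> fv fw; apply: weakly_separatedP => l.
have [[Rv Iv] [Rw Iw]] := (fv l, fw l); apply/eqP; rewrite eq_complex.
rewrite (simplex_integral_unique Rv Rw) (simplex_integral_unique Iv Iw).
by rewrite !eqxx.
Qed.

Lemma expop_unique (A : V -> V) v w :
  weak_cvg (exp_series A v) w -> expop A v = w.
Proof.
by move=> Avw; apply: xget_unique => // u /weak_cvg_unique; exact.
Qed.

(** The real eigenvectors of [F] span, stated as an induction principle so that no eigenbasis has to
    be chosen. *)
Definition real_diagonalizable (F : V -> V) :=
  forall P : V -> Prop,
    (forall a u v, P u -> P v -> P (a *: u + v)) ->
    (forall (x : R) v, F v = x%:C *: v -> P v) -> forall v, P v.

Lemma expop_eigen (F : {linear V -> V}) (t x : R) v : F v = x%:C *: v ->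
  expop (fun u => t%:C *: F u) v = (expR (t * x))%:C *: v.
Proof.
move=> Fv; apply/expop_unique/(@exp_series_eigen_cvg _ _ (t%:C \*: F)).
by rewrite /= Fv scalerA rmorphM.
Qed.

(** Since [expop] takes a default value where the series diverges, convergence comes first: it holds
    on eigenvectors and passes to linear combinations. Linearity then follows from that of the
    partial sums. *)
Lemma expop_diagonalizable_linear (F : {linear V -> V}) (t : R) :
  real_diagonalizable F -> linear (expop (fun u => t%:C *: F u)).
Proof.
move=> Fdiag; have expF v : weak_cvg (exp_series (fun u => t%:C *: F u) v)
    (expop (fun u => t%:C *: F u) v).
  suff [w vw] : exists w, weak_cvg (exp_series (fun u => t%:C *: F u) v) w.
    by rewrite (expop_unique vw).
  elim/Fdiag: v => [a u v [u' uu'] [v' vv']|x v Fv].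
    exists (a *: u' + v'); have := weak_cvgZD (a := a) uu' vv'; congr weak_cvg.
    by apply/funext => k; rewrite -(exp_series_linear (t%:C \*: F)).
  eexists; apply: (@exp_series_eigen_cvg _ _ (t%:C \*: F) (t * x)).
  by rewrite /= Fv scalerA rmorphM.
move=> a u v; apply: expop_unique.
have := weak_cvgZD (a := a) (expF u) (expF v); congr weak_cvg.
by apply/funext => k; rewrite -(exp_series_linear (t%:C \*: F)).
Qed.

(* [N] lowers the eigenvalues of [F] by 1, whence the factor
   [exp (- t (x - 1)) exp (t x)] on the eigenspace for [x]. *)
Lemma theta_commutator (F N : {linear V -> V}) t v :
  real_diagonalizable F -> (forall u, F (N u) = N (F u) - N u) ->
  theta F t N v = (expR t)%:C *: N v.
Proof.
move=> Fdiag FN; rewrite /theta/=.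
have expF s := expop_diagonalizable_linear s Fdiag.
elim/Fdiag: v => [a u v IHu IHv|x v Fv].
  rewrite (expF t) !linearP/= (expF (- t)).
  by rewrite IHu IHv.
have FNv : F (N ((expR (t * x))%:C *: v)) =
    (x - 1)%:C *: N ((expR (t * x))%:C *: v).
  have Fw : F ((expR (t * x))%:C *: v) = x%:C *: ((expR (t * x))%:C *: v).
    by rewrite linearZ/= Fv !scalerA mulrC.
  by rewrite FN Fw linearZ/= rmorphB/= scalerBl scale1r.
rewrite (expop_eigen _ Fv) (expop_eigen _ FNv) linearZ/= scalerA.
by rewrite -rmorphM/= -expRD mulNr -mulrN -mulrDr opprB subrK mulr1.
Qed.

End separated.

(** * Extensionality, derivatives of polynomials, real scalars *)

Lemma linear_eq (K : pzSemiRingType) (U : lSemiModType K)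
    (W : nmodType) s (f g : {linear U -> W | s}) : f =1 g -> f = g.
Proof.
case: f g => [f cf] [g cg] /funext/= fg; case: _ / fg in cg *.
congr GRing.Linear.Pack.
case: cf cg => [[a] [b]] [[c] [d]].
by rewrite (Prop_irrelevance a c) (Prop_irrelevance b d).
Qed.

(** Uniqueness is an equality of [aut]-valued maps, while the series only determines the inverse as
    a function. The inverse determines the automorphism, and proof irrelevance identifies the
    remaining fields. *)
Lemma aut_inv_inj (R : realType) (V : lmodType R[i]) (a b : aut V) :
  aut_inv a =1 aut_inv b -> a = b.
Proof.
case: a b => [f g fK gK] [f' g' fK' gK']/= gg.
have ff : f =1 f' by move=> v; rewrite -{1}[v]fK' -gg gK.
rewrite (linear_eq ff) (linear_eq gg) in fK gK *.
by congr Aut; apply: Prop_irrelevance.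
Qed.

(** Only lists of length [k] ever reach the integrand; hence [size s] can be replaced by [k] in the
    closed form of [theta_prod]. *)
Lemma is_simplex_integral_ext (R : realType) k (D : set R) F G (I : R) :
  (forall s, size s = k -> F s = G s) ->
  is_simplex_integral k D F I -> is_simplex_integral k D G I.
Proof.
elim: k D F G I => [|k IHk] D F G I /= FG; first by rewrite -FG.
move=> [H [FH iH ->]]; exists H; split=> // s Ds.
by apply: IHk (FH s Ds) => ss sz; apply: FG => /=; rewrite sz.
Qed.

Lemma is_derive_expRM (R : realType) (c t : R) :
  is_derive t 1 (fun s : R => expR s * c) (expR t * c).
Proof.
rewrite (_ : (fun s => _) = c \*: expR); last first.
  by apply/funext => s; rewrite mulrC.
by apply: is_derive_eq; rewrite mulrC.
Qed.

(** On a vector killed by a power of [N], the exponential is such a polynomial. In the term [k = 0]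
    the truncated exponent [k.-1] is harmless, as the factor [k] vanishes. *)
Lemma is_derive_monomials (K : numFieldType) (a : nat -> K) m (w : K) :
  is_derive (w : K^o) 1 (fun z : K^o => \sum_(0 <= k < m) z ^+ k * a k : K^o)
    (\sum_(0 <= k < m) k%:R * w ^+ k.-1 * a k).
Proof.
elim: m => [|m IHm].
  rewrite big_geq// (_ : (fun z => _) = cst 0); first exact: is_derive_cst.
  by apply/funext => z; rewrite big_geq.
have dX : is_derive (w : K^o) 1 (fun z : K^o => z ^+ m : K^o)
    (m%:R * w ^+ m.-1).
  have := @is_deriveX K K^o (fun z => z) m (w : K^o) 1 1 (is_derive_id _ _).
  by rewrite exprfctE /GRing.scale/= mulr1.
have := @is_deriveD K K^o K^o _ _ _ _ _ _ IHm
  (@is_deriveZ K K^o K^o _ (a m) _ _ _ dX).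
rewrite big_nat_recr//= /GRing.scale/= [a m * _]mulrC; congr is_derive.
by apply/funext => z; rewrite big_nat_recr//= mulrC.
Qed.

Lemma Re_realM (R : realType) (x : R) (z : R[i]) :
  complex.Re (x%:C * z) = x * complex.Re z.
Proof. by case: z => a b /=; rewrite mul0r subr0. Qed.

Lemma Im_realM (R : realType) (x : R) (z : R[i]) :
  complex.Im (x%:C * z) = x * complex.Im z.
Proof. by case: z => a b /=; rewrite mul0r addr0. Qed.

Lemma P1chartK (R : realType) (w : R[i]) : P1inv (P1chart w) = w.
Proof.
by rewrite /P1inv /= /P1chart_val; case: eqVneq => [->//|_]; rewrite invrK.
Qed.

(** * The theorem for a diagonalizable [F] and a locally nilpotent [N] with [[N, F] = N] *)

Section birkhoff.
Variables (R : realType) (V : lmodType R[i]) (F N : {linear V -> V}).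
Hypothesis Vsep : weakly_separated V.
Hypothesis Fdiag : real_diagonalizable F.
Hypothesis FN : forall v, F (N v) = N (F v) - N v.
Hypothesis Nnil : forall v, exists m, iter m N v = 0.

Lemma iter_scale0 (z : R[i]) m v :
  iter m N v = 0 -> iter m (fun u => z *: N u) v = 0.
Proof. by move=> Nv; rewrite iter_scale Nv scaler0. Qed.

Lemma expop_nilpotent (z : R[i]) m v : iter m N v = 0 ->
  expop (fun u => z *: N u) v = exp_series (fun u => z *: N u) v m.
Proof.
move=> Nv; apply: expop_unique => //; apply: (@weak_cvg_eventually _ _ _ _ m).
move=> k mk; rewrite (@exp_series_stable _ _ (z \*: N) v m)//.
exact: iter_scale0.
Qed.

Lemma nilpotent2 u v : exists m, iter m N u = 0 /\ iter m N v = 0.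
Proof.
have [[m Nu] [m' Nv]] := (Nnil u, Nnil v); exists (m + m')%N; split.
  by rewrite addnC iterD Nu iter0r.
by rewrite iterD Nv iter0r.
Qed.

Lemma expop_nilpotent_linear (z : R[i]) : linear (expop (fun u => z *: N u)).
Proof.
move=> a u v; have [m [Nu Nv]] := nilpotent2 u v.
rewrite !(@expop_nilpotent _ m)//; last first.
  by rewrite linearP/= Nu Nv scaler0 addr0.
exact: (exp_series_linear (z \*: N)).
Qed.

HB.instance Definition _ z :=
  GRing.isLinear.Build _ _ _ _ _ (expop_nilpotent_linear z).

Lemma expop_nilpotentNK (z : R[i]) :
  cancel (expop (fun u => z *: N u)) (expop (fun u => - z *: N u)).
Proof.
move=> v; have [m Nv] := Nnil v; rewrite (expop_nilpotent _ Nv).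
rewrite (@expop_nilpotent _ m).
  rewrite -[RHS](@exp_seriesNK _ _ (z \*: N) v m) ?iter_scale0//=.
  by congr exp_series; apply/funext => u; rewrite scaleNr.
(* The same [m] serves for the image of [v], because [N] commutes with every term of the series. *)
rewrite /exp_series linear_sum big1// => k _.
by rewrite linearZ/= iter_scale linearZ/= -iterD addnC iterD Nv iter0r !scaler0.
Qed.

Lemma expop_nilpotentK (z : R[i]) :
  cancel (expop (fun u => - z *: N u)) (expop (fun u => z *: N u)).
Proof. by have := @expop_nilpotentNK (- z); rewrite opprK. Qed.

Definition exp_aut (z : R[i]) : aut V :=
  Aut (@expop_nilpotentNK z) (@expop_nilpotentK z).

Lemma is_exp_exp_aut z : is_exp (fun u => z *: N u) (exp_aut z).
Proof.
move=> v; have [m Nv] := Nnil v.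
apply: (@weak_cvg_eventually _ _ _ _ m) => k mk.
rewrite /= (expop_nilpotent _ Nv) (@exp_series_stable _ _ (z \*: N) v m)//.
exact: iter_scale0.
Qed.

(** The constant [c] lets one formula treat the map ([c = -1]) and its inverse ([c = 1]) in the
    coordinate [1 / z]. *)
Lemma is_derive_expop (l : {scalar V}) v (c w : R[i]) m : iter m N v = 0 ->
  is_derive (w : R[i]^o) 1
    (fun z : R[i]^o => l (expop (fun u => (c * z) *: N u) v) : R[i]^o)
    (\sum_(0 <= k < m)
       k%:R * w ^+ k.-1 * (c ^+ k * (k`!%:R^-1 * l (iter k N v)))).
Proof.
move=> Nv; have := is_derive_monomials
  (fun k => c ^+ k * (k`!%:R^-1 * l (iter k N v))) m w.
congr is_derive; apply/funext => z; rewrite (expop_nilpotent _ Nv) linear_sum.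
apply: eq_bigr => k _; rewrite iter_scale !linearZ/= exprMn.
by rewrite [LHS]mulrA [z ^+ k * _]mulrC [RHS]mulrCA.
Qed.

Lemma theta_prodE (s : seq R) v :
  theta_prod F N s v = (\prod_(x <- s) expR (- x))%:C *: iter (size s) N v.
Proof.
elim: s => [|x s IHs]; first by rewrite big_nil scale1r.
rewrite /= theta_commutator// IHs linearZ/= scalerA big_cons.
by rewrite rmorphM.
Qed.

Lemma theta_prod_integral k v : (0 < k)%N ->
  is_weak_simplex_integral k (fun s => theta_prod F N s v)
    (k`!%:R^-1 *: iter k N v).
Proof.
(* The factor [1 / k!] is real, so it passes through real and imaginary parts. *)
move=> k0 l; have invE : k`!%:R^-1 = (k`!%:R^-1 : R)%:C.
  by rewrite fmorphV rmorph_nat.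
split; rewrite linearZ/= invE.
  rewrite Re_realM.
  apply: is_simplex_integral_ext (is_simplex_integral_prod_expRy _ k0).
  by move=> s sk; rewrite theta_prodE linearZ/= Re_realM sk.
rewrite Im_realM.
apply: is_simplex_integral_ext (is_simplex_integral_prod_expRy _ k0).
by move=> s sk; rewrite theta_prodE linearZ/= Im_realM sk.
Qed.

Lemma Upsilon_commutator : is_Upsilon F N N.
Proof.
move=> v l; split.
  have := is_derive_expRM (complex.Re (l (N v))) 0; rewrite expR0 mul1r.
  congr is_derive; apply/funext => s.
  by rewrite theta_commutator// linearZ/= Re_realM.
have := is_derive_expRM (complex.Im (l (N v))) 0; rewrite expR0 mul1r.
congr is_derive; apply/funext => s.
by rewrite theta_commutator// linearZ/= Im_realM.
Qed.

Lemma exp_aut_holomorphic :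
  P1holomorphic (fun z : P1star R => exp_aut (- P1inv z)).
Proof.
move=> v w l; have [m Nv] := Nnil v.
have [dl _] := is_derive_expop l (- 1) w Nv.
rewrite (_ : (fun z => _) =
  (fun z : R[i]^o => l (expop (fun u => (- 1 * z) *: N u) v) : R[i]^o));
  first exact: dl.
by apply/funext => z; rewrite /= P1chartK mulN1r.
Qed.

Lemma exp_aut_residue :
  is_residue (fun z : P1star R => exp_aut (- P1inv z)) N.
Proof.
move=> v l /=; have [m Nv] := Nnil v.
(* The exponent is raised by 2 so that the terms [k = 0] and [k = 1] can be split off; at 0 only
   [k = 1] contributes to the derivative. *)
have Nv2 : iter m.+2 N v = 0 by rewrite !iterS Nv !linear0.
have := is_derive_expop l 1 0 Nv2; congr is_derive.
  by apply/funext => z; rewrite /= P1chartK opprK mul1r.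
rewrite big_nat_recl// big_nat_recl// big1 => [|k _].
  by rewrite !mul0r add0r addr0 !mul1r invr1 mul1r.
by rewrite [0 ^+ _](exprS 0 k) mul0r mulr0 mul0r.
Qed.

Lemma exp_aut_unique :
  unique (fun psi : P1star R -> aut V =>
      P1holomorphic psi /\
      exists (Res beta : V -> V) (d : nat -> V -> V),
        [/\ is_residue psi Res,
            Res = N,
            is_Upsilon F Res beta,
            (forall k, (0 < k)%N -> forall v,
              is_weak_simplex_integral k
                (fun s => theta_prod F beta s v) (d k v))
          & forall z v,
              weak_cvg
                (fun m => v + \sum_(1 <= k < m) P1inv z ^+ k *: d k v)
                (aut_inv (psi z) v)]) (fun z => exp_aut (- P1inv z)).
Proof.
(* Positivity of [m] is essential: at [m = 0] the left side is [v] and the exponential sum is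
   empty. *)
have seriesE (z : R[i]) v m : (0 < m)%N ->
    v + \sum_(1 <= k < m) z ^+ k *: (k`!%:R^-1 *: iter k N v) =
    exp_series (fun u => z *: N u) v m.
  case: m => // m _; rewrite /exp_series [RHS]big_ltn// invr1 scale1r.
  congr (_ + _); apply: eq_bigr => k _.
  by rewrite iter_scale !scalerA mulrC.
split.
  split; first exact: exp_aut_holomorphic.
  exists N, N, (fun k v => k`!%:R^-1 *: iter k N v); split=> //.
  - exact: exp_aut_residue.
  - exact: Upsilon_commutator.
  - by move=> k k0 v; exact: theta_prod_integral.
  - move=> z v /=; have [m Nv] := Nnil v.
    rewrite opprK (expop_nilpotent _ Nv).
    apply: (@weak_cvg_eventually _ _ _ _ m.+1) => k mk.
    rewrite seriesE ?(leq_trans _ mk)//.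
    rewrite (@exp_series_stable _ _ (P1inv z \*: N) v m)//; last exact: ltnW.
    exact: iter_scale0.
(* The data determine each other in turn: the residue [N] gives [beta] by uniqueness of derivatives,
   [beta] gives each [d k] by uniqueness of integrals, and the series gives the inverse of [psi z]
   by uniqueness of limits. *)
move=> psi [_ [_ [beta [d [_ -> betaE dE psiE]]]]].
have {}betaE : beta = N.
  apply/funext => v.
  exact: (is_weak_Rderive_unique Vsep (betaE v) (Upsilon_commutator v)).
rewrite {}betaE in dE.
apply/funext => z; apply: aut_inv_inj => v /=.
rewrite opprK; apply: (weak_cvg_unique Vsep _ (psiE z v)).
have [m Nv] := Nnil v; rewrite (expop_nilpotent _ Nv).
apply: (@weak_cvg_eventually _ _ _ _ m.+1) => k mk.
rewrite -(@exp_series_stable _ _ (P1inv z \*: N) v m k) ?iter_scale0//;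
  last exact: ltnW.
rewrite -seriesE ?(leq_trans _ mk)//; congr (_ + _).
apply: eq_big_nat => j /andP[j0 _]; congr (_ *: _).
exact: (is_weak_simplex_integral_unique Vsep (dE j j0 v)
  (theta_prod_integral v j0)).
Qed.

End birkhoff.

(** * Linear maps, linear forms and induction on a complexification *)

Section complexification_theory.
Variables (R : realType) (V : lmodType R).
Local Notation VC := (complexification V).

Lemma complexify_linear (f : {linear V -> V}) :
  linear (complexify f : VC -> VC).
Proof.
move=> [a b] [x y] [u v].
by congr pair; rewrite /= !linearD/= ?linearN/= !(linearZ_LR f).
Qed.

(** A real form [f] extends to the complex form sending x + iy to f(x) + i f(y), whose vanishing
    forces that of both parts. *)
Lemma complexification_separated :
  (forall x : V, (forall f : {scalar V}, f x = 0) -> x = 0) ->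
  weakly_separated VC.
Proof.
move=> Vsep [x y] xy0; have l_linear (f : {scalar V}) :
    scalar (fun v : VC => f v.1 +i* f v.2).
  move=> [a b] [u u'] [v v']; apply/eqP; rewrite eq_complex/=.
  by rewrite !linearD/= !linearN/= !(linearZ_LR f)/= !eqxx.
have fxy (f : {scalar V}) : f x = 0 /\ f y = 0.
  pose l : {scalar VC} := HB.pack (fun v : VC => f v.1 +i* f v.2)
    (GRing.isLinear.Build _ _ _ _ _ (l_linear f)).
  by have [] := xy0 l.
by congr pair; apply: Vsep => f; have [] := fxy f.
Qed.

(** Every vector is [i] times a real vector plus a real vector. *)
Lemma complexification_ind (P : VC -> Prop) :
  (forall a u v, P u -> P v -> P (a *: u + v)) ->
  (forall x : V, P (x, 0)) -> forall v, P v.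
Proof.
move=> PL P0 [x y]; have := PL 'i%C _ _ (P0 y) (P0 x); congr P.
by congr pair; rewrite /= ?scale0r ?scaler0 ?scale1r ?subr0 ?addr0 ?add0r.
Qed.

Lemma complexification_scale_real (a : R) (x : V) :
  (a *: x, 0) = a%:C *: ((x, 0) : VC) :> VC.
Proof. by congr pair; rewrite /= !scale0r ?subr0 // scaler0 addr0. Qed.

Lemma complexification_realD (a : R) (x y : V) :
  (a *: x + y, 0) = a%:C *: ((x, 0) : VC) + ((y, 0) : VC) :> VC.
Proof. by rewrite -complexification_scale_real; congr pair; rewrite /= addr0. Qed.

End complexification_theory.

(** * Induction and linear maps on a spanned subspace *)

Section spanned_theory.
Variables (R : pzRingType) (V : lmodType R) (S : set V).

Lemma spanned_gen_subproof g : S g -> g \in rspan_pred S.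
Proof. by move=> Sg; apply/asboolP/rspan_gen. Qed.

Definition spanned_gen g (Sg : S g) : spanned S :=
  Spanned (spanned_gen_subproof Sg).

Lemma spanned_ind (P : spanned S -> Prop) :
  P 0 -> (forall a u v, P u -> P v -> P (a *: u + v)) ->
  (forall g (Sg : S g), P (spanned_gen Sg)) -> forall v, P v.
Proof.
move=> P0 PL Pg v; have [m [c [g [Sg vE]]]] := asboolP _ (valP v).
have -> : v = \sum_(i < m) c i *: spanned_gen (Sg i).
  apply: val_inj; rewrite linear_sum vE.
  by apply: eq_bigr => i _; rewrite linearZ.
by elim/big_rec: _ => // i u _; exact: PL.
Qed.

Lemma spanned_map_linear (f : V -> V) (fL : linear f)
    (fS : forall v, S v -> rspan S (f v)) :
  linear (spanned_map fL fS).
Proof.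
move=> a u v; apply: val_inj; rewrite [RHS]linearP.
by rewrite -[LHS]/(f (val (a *: u + v))) linearP fL.
Qed.

HB.instance Definition _ (f : V -> V) (fL : linear f)
    (fS : forall v, S v -> rspan S (f v)) :=
  GRing.isLinear.Build _ _ _ _ _ (spanned_map_linear fL fS).

End spanned_theory.

(** * The hypotheses of the abstract theorem for [TC X] *)

Section T_theory.
Variables (R : realType) (n : nat) (X : complexManifold R n).

HB.instance Definition _ :=
  GRing.isLinear.Build _ _ _ _ (N X : TC X -> TC X) (complexify_linear _).

HB.instance Definition _ :=
  GRing.isLinear.Build _ _ _ _ (Phi X : TC X -> TC X) (complexify_linear _).

Lemma T_valP (a : R) (u v : T X) i y :
  val (a *: u + v) i y = a *: (val u i y : Rcomplex R) + val v i y.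
Proof. by rewrite linearP. Qed.

Lemma T_Re_linear i y : scalar (fun t : T X => complex.Re (val t i y)).
Proof.
by move=> a u v; rewrite T_valP; case: (val u i y) (val v i y) => ? ? [].
Qed.

Lemma T_Im_linear i y : scalar (fun t : T X => complex.Im (val t i y)).
Proof.
by move=> a u v; rewrite T_valP; case: (val u i y) (val v i y) => ? ? [].
Qed.

Lemma complex_eq0 (z : R[i]) : complex.Re z = 0 -> complex.Im z = 0 -> z = 0.
Proof. by case: z => a b /= -> ->. Qed.

(** The real and imaginary parts of all values of the component forms are linear forms, and they
    determine the element. *)
Lemma T_separated (x : T X) : (forall f : {scalar T X}, f x = 0) -> x = 0.
Proof.
move=> x0; apply: val_inj; apply/funext => i; apply/funext => y.
pose fRe : {scalar T X} := HB.pack (fun t : T X => complex.Re (val t i y))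
  (GRing.isLinear.Build _ _ _ _ _ (T_Re_linear i y)).
pose fIm : {scalar T X} := HB.pack (fun t : T X => complex.Im (val t i y))
  (GRing.isLinear.Build _ _ _ _ _ (T_Im_linear i y)).
exact: complex_eq0 (x0 fRe) (x0 fIm).
Qed.

Lemma TC_separated : weakly_separated (TC X).
Proof. exact/complexification_separated/T_separated. Qed.

Lemma Phi_N (v : TC X) : Phi X (N X v) = N X (Phi X v) - N X v.
Proof.
have PhiN (t : Tambient X) :
    Phiambient (Nambient t) = Nambient (Phiambient t) - Nambient t.
  apply/funext => -[[[p q] r] k].
  transitivity ((Nambient (Phiambient t) : Tambient X) (p, q, r, k) -
    Nambient t (p, q, r, k)); last by [].
  rewrite /Phiambient /Nambient; case: ifP => _; last by rewrite scaler0 subr0.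
  (* [Nambient] reads its argument at [r - 1], where [Phiambient] multiplies by [-(r - 1)] instead
     of [-r]. *)
  have -> : (- r)%:~R = (- (r - 1))%:~R - 1 :> R.
    by rewrite opprB rmorphB/= rmorphN/= addrAC subrr add0r.
  by rewrite scalerBl scale1r.
pose NT := spanned_map (@Nambient_linear R n X) (@Nambient_span R n X).
pose PhiT := spanned_map (@Phiambient_linear R n X) (@Phiambient_span R n X).
have PhiNT x : PhiT (NT x) = NT (PhiT x) - NT x.
  by apply: val_inj; rewrite [RHS]linearB; exact: PhiN.
by case: v => x y; congr pair; exact: PhiNT.
Qed.

Lemma Phi_diagonalizable : real_diagonalizable (Phi X).
Proof.
move=> P PL Peig; apply: complexification_ind => //.
apply: spanned_ind => [|a u v Pu Pv|g Sg].
- by apply: (Peig 0); rewrite scale0r linear0.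
- by rewrite complexification_realD; exact: PL.
have [p [q [xi [r [k [_ _ gE]]]]]] := Sg.
apply: (Peig (- r)%:~R); rewrite -complexification_scale_real.
congr pair; last exact: linear0.
by apply: val_inj; rewrite linearZ/= gE Phiambient_Tgen.
Qed.

(** Each step raises [r] and [k] by one, so the slack in [2 * r + (p + q) <= k] drops by one. After
    one step more than the initial slack, the indices have left [Lambda]. *)
Lemma iter_Nambient_Tgen p q xi r k : Lambda p q r k ->
  exists m, iter m (@Nambient R n X) (Tgen p q xi r k) = 0.
Proof.
move=> L; have N0 m : iter m (@Nambient R n X) 0 = 0.
  elim: m => // m IHm; rewrite iterS IHm.
  by apply/funext => -[[[? ?] ?] ?]; rewrite /Nambient; case: ifP.
pose j := (absz (k - 2 * r - (p + q)%:Z)%R).+1; exists j.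
have [->//|[_]] : iter j (@Nambient R n X) (Tgen p q xi r k) = 0 \/
    iter j (@Nambient R n X) (Tgen p q xi r k) =
      Tgen p q xi (r + j%:Z) (k + j%:Z) /\
    Lambda p q (r + j%:Z) (k + j%:Z).
  elim: j => [|j [IHj|[IHj Lj]]]; first by right; rewrite !addr0.
    by left; rewrite iterS IHj; exact: (N0 1%N).
  rewrite iterS IHj Nambient_Tgen; case: ifP => [Lj1|_]; last by left.
  by right; rewrite -addn1 PoszD !addrA.
by rewrite /Lambda => /and3P[_ + _]; rewrite /j; lia.
Qed.

Lemma N_nilpotent (v : TC X) : exists m, iter m (N X) v = 0.
Proof.
have closed a (u w : TC X) : (exists m, iter m (N X) u = 0) ->
    (exists m, iter m (N X) w = 0) -> exists m, iter m (N X) (a *: u + w) = 0.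
  (* The exponent depends on the vector; for a combination, the sum of the two exponents works. *)
  move=> [m Nu] [m' Nw]; exists (m + m')%N.
  by rewrite iterZD {1}addnC !iterD Nu Nw !iter0r scaler0 addr0.
move: v; apply: complexification_ind => //.
apply: spanned_ind => [|a u w Pu Pw|g Sg].
- by exists 0%N.
- by rewrite complexification_realD; exact: closed.
have [p [q [xi [r [k [_ L gE]]]]]] := Sg.
have [m Nm] := iter_Nambient_Tgen xi L; exists m.
pose NT := spanned_map (@Nambient_linear R n X) (@Nambient_span R n X).
have iterN j :
    iter j (N X) (spanned_gen Sg, 0) = (iter j NT (spanned_gen Sg), 0).
  elim: j => // j IHj; rewrite !iterS IHj; congr pair; exact: linear0.
have valN j : val (iter j NT (spanned_gen Sg)) = iter j (@Nambient R n X) g.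
  by elim: j => // j IHj; rewrite !iterS -IHj.
by rewrite iterN; congr pair; apply: val_inj; rewrite valN gE Nm.
Qed.

End T_theory.

Unset Implicit Arguments.

Theorem theorem5p1 (R : realType) (n : nat) (X : compactKahler R n) :
  exists phi : P1star R -> aut (TC X),
    unique (fun psi : P1star R -> aut (TC X) =>
      P1holomorphic psi /\
      exists (Res beta : TC X -> TC X) (d : nat -> TC X -> TC X),
        [/\ is_residue psi Res,
            Res = N X,
            is_Upsilon (Phi X) Res beta,
            (forall k, (0 < k)%N -> forall v,
              is_weak_simplex_integral k
                (fun s => theta_prod (Phi X) beta s v) (d k v))
          & forall z v,
              weak_cvg
                (fun m => v + \sum_(1 <= k < m) P1inv z ^+ k *: d k v)
                (aut_inv (psi z) v)]) phi
    /\ forall z, is_exp (fun v => - P1inv z *: N X v) (phi z).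
Proof.
(* [P1inv] vanishes at infinity, where the map is therefore the identity. *)
exists (fun z =>
  exp_aut (@TC_separated R n X) (@N_nilpotent R n X) (- P1inv z)).
split; last by move=> z; exact: is_exp_exp_aut.
exact: exp_aut_unique (@Phi_diagonalizable R n X) (@Phi_N R n X) _.
Qed.
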